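(* There exists a bounded sequence $\mathbf w=(w_n)_{n\geq 1}$ of positive real numbers such that the unilateral weighted shift $B_{\mathbf w}$ on $c_0(\mathbb Z_+)$, defined by $B_{\mathbf w}(e_n)=w_ne_{n-1}$ for $n\ge1$ and $B_{\mathbf w}(e_0)=0$, satisfies: (i) $B_{\mathbf w}$ is $\mathcal U$-frequently hypercyclic on $c_0(\mathbb Z_+)$; (ii) $B_{\mathbf w}$ is not frequently hypercyclic on $c_0(\mathbb Z_+)$.
   Context: $(e_n)_{n\in\mathbb Z_+}$ is the standard basis of $c_0(\mathbb Z_+)$ (sequences tending to $0$, sup norm), $\mathbb Z_+=\{0,1,2,\dots\}$. For $A\subset\mathbb Z_+$ let $A(n)=\{a\in A: a\le n\}$, $\underline d(A)=\liminf_{n\to+\infty}\frac{\#A(n)}{n}$ (lower density) and $\bar d(A)=\limsup_{n\to+\infty}\frac{\#A(n)}{n}$ (upper density). A bounded operator $T$ on a Banach space $X$ is frequently hypercyclic (resp. $\mathcal U$-frequently hypercyclic) if there is a vector $x\in X$ such that for every nonempty open $U\subset X$ the set $\{n\in\mathbb Z_+: T^nx\in U\}$ has positive lower density (resp. positive upper density). *)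

(* Defs.v *)
From HB Require Import structures.
From mathcomp Require Import all_boot all_order all_algebra.
From mathcomp Require Import all_classical all_reals all_analysis.
From mathcomp Require Import complex.

Set Implicit Arguments.
Unset Strict Implicit.
Unset Printing Implicit Defensive.

Import Order.TTheory GRing.Theory Num.Theory.
Import numFieldNormedType.Exports.

Local Open Scope classical_set_scope.
Local Open Scope ring_scope.

Section density.
Context (R : realType).
Implicit Type A : set nat.

(* The term n = 0 is 1 / 0 or 0 / 0, i.e. 0; it does not affect the limits.   *)
Definition density_ratio A (n : nat) : R :=
  #|[pred a : 'I_n.+1 | (a : nat) \in A]|%:R / n%:R.

Definition lower_density A : \bar R := limn_einf (EFin \o density_ratio A).

Definition upper_density A : \bar R := limn_esup (EFin \o density_ratio A).

End density.

Section frequent_hypercyclicity.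
Context (R : realType) (K : numFieldType) (X : normedModType K).
Implicit Type T : {linear X -> X}.

Definition visits T (x : X) (U : set X) : set nat := [set n | U (iter n T x)].

Definition frequently_hypercyclic T := exists x : X,
  forall U : set X, open U -> U !=set0 ->
    (0 < lower_density R (visits T x U))%E.

Definition U_frequently_hypercyclic T := exists x : X,
  forall U : set X, open U -> U !=set0 ->
    (0 < upper_density R (visits T x U))%E.

End frequent_hypercyclicity.

Arguments frequently_hypercyclic R {K X} T.
Arguments U_frequently_hypercyclic R {K X} T.

Section null_sequences.
Context (K : numFieldType).

Definition null_seq : {pred nat -> K} :=
  fun x => `[< x n @[n --> \oo] --> (0 : K) >].

Lemma null_seqP (x : nat -> K) :
  reflect (x n @[n --> \oo] --> (0 : K)) (x \in null_seq).
Proof. exact: asboolP. Qed.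

Lemma null_seq_submod : submod_closed null_seq.
Proof.
split; first by apply/null_seqP; exact: cvg_cst.
move=> a x y /null_seqP x0 /null_seqP y0; apply/null_seqP.
rewrite -[0 : K]addr0 -{1}(mulr0 a).
by apply: cvgD => //; apply: cvgMl_tmp.
Qed.

HB.instance Definition _ :=
  GRing.isSubmodClosed.Build K (nat -> K) null_seq null_seq_submod.

Record c0 := C0 { c0_val :> nat -> K; c0_valP : c0_val \in null_seq }.

HB.instance Definition _ := [isSub for c0_val].
HB.instance Definition _ := [Choice of c0 by <:].
HB.instance Definition _ := [SubChoice_isSubLmodule of c0 by <:].

(* Norms over a numFieldType K take their values in K, also for K = R[i].     *)
Definition c0_norm (x : c0) : K := supremum 0 (range (fun n => `|x n|)).

(* The supremum is attained, which is why it exists for every numFieldType.   *)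
Lemma c0_norm_max (x : c0) :
  (forall n, `|x n| <= c0_norm x) /\ exists n, c0_norm x = `|x n|.
Proof.
suff [m mP] : exists m, forall n, `|x n| <= `|x m|.
  have xm : supremums (range (fun n => `|x n|)) `|x m|.
    by split=> [_ [n _ <-]//|y]; apply; exists m.
  suff -> : c0_norm x = `|x m| by split=> //; exists m.
  rewrite /c0_norm /supremum ifF; last first.
    by apply/negbTE/set0P; exists `|x m|, m.
  case: xgetP => [y _ yP|/(_ _ xm)//].
  exact: (is_subset1_supremums yP xm).
have max_upto N : exists2 m, (m <= N)%N &
    forall n, (n <= N)%N -> `|x n| <= `|x m|.
  elim: N => [|N [m mN mP]].
    by exists 0%N => // n; rewrite leqn0 => /eqP->.
  have [xm|/ltW xm] := real_leP (normr_real (x N.+1)) (normr_real (x m)).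
    exists m; first exact: leqW.
    by move=> n; rewrite leq_eqVlt => /predU1P[->//|]; exact: mP.
  exists N.+1 => // n; rewrite leq_eqVlt => /predU1P[->//|nN].
  exact: le_trans (mP _ nN) xm.
have [x0|/existsNP[k /eqP xk]] := pselect (forall k, x k = 0).
  by exists 0%N => n; rewrite !x0.
have /null_seqP/cvgr0Pnorm_lt/(_ `|x k|) := c0_valP x.
rewrite normr_gt0 => /(_ xk)[N _ xN].
have [m _ mP] := max_upto (maxn N k).
exists m => n; have [nN|/ltnW Nn] := leqP n (maxn N k); first exact: mP.
apply: le_trans (mP k (leq_maxr _ _)); apply/ltW/xN => /=.
exact: leq_trans (leq_maxl _ _) Nn.
Qed.

Lemma c0_norm_ge (x : c0) n : `|x n| <= c0_norm x.
Proof. exact: (c0_norm_max x).1. Qed.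

Lemma c0_norm_le (x : c0) (M : K) : (forall n, `|x n| <= M) -> c0_norm x <= M.
Proof. by move=> xM; have [n ->] := (c0_norm_max x).2. Qed.

Lemma c0_ler_normD x y : c0_norm (x + y) <= c0_norm x + c0_norm y.
Proof.
apply: c0_norm_le => n; apply: le_trans (ler_normD _ _) _.
by apply: lerD; exact: c0_norm_ge.
Qed.

Lemma c0_normrZ (l : K) x : c0_norm (l *: x) = `|l| * c0_norm x.
Proof.
apply/le_anti/andP; split.
  apply: c0_norm_le => n; rewrite [(l *: x) n]/(l * x n) normrM.
  by apply: ler_wpM2l => //; exact: c0_norm_ge.
have [n ->] := (c0_norm_max x).2.
by rewrite -normrM; exact: c0_norm_ge (l *: x) n.
Qed.

Lemma c0_normr0_eq0 x : c0_norm x = 0 -> x = 0.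
Proof.
move=> x0; apply/val_inj/funext => n; apply/eqP; rewrite -normr_le0.
by rewrite -x0; exact: c0_norm_ge.
Qed.

HB.instance Definition _ :=
  Lmodule_isNormed.Build K c0 c0_ler_normD c0_normrZ c0_normr0_eq0.

Lemma c0_unit_subproof n : (fun k => (k == n)%:R : K) \in null_seq.
Proof.
apply/null_seqP; apply: cvg_near_cst; exists n.+1 => //= k nk.
by rewrite gtn_eqF.
Qed.

Definition c0_unit n : c0 := C0 (c0_unit_subproof n).

End null_sequences.

(* K is R or C over the real type R, given with the embedding R -> K.         *)
Variant scalar_field (R : realType) : forall K : numFieldType, (R -> K) -> Prop :=
| RealScalars : @scalar_field R R (fun x : R => x)
| ComplexScalars : @scalar_field R R[i] (real_complex R).

(* Main.v *)
(* Take w_1 ... w_n = 2^(h n), where the height h grows by at most 1 at each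
   step, so that w_n <= 2.  Cut the integers by a rapidly growing sequence c_k.

   On [c_k, 8 c_k] the height is n - c_k (or more).  Every k has a type p <= k,
   each type occurring infinitely often, and the U-frequently hypercyclic vector
   x carries on [2 c_k, 4 c_k) shifted copies of a finite vector y_p placed at
   the multiples of an integer P_p, where (y_p) is dense.  Each copy returns to
   y_p; the error comes from the later copies and is governed by the products at
   the differences of positions.  Between different blocks these differences lie
   in the ramps [c_k, 8 c_k]; within one block they are close to positive
   multiples of P_p, so h also gets a bump of height about p there.  The visits
   close to y_p then have upper density at least 1 / (2 P_p).

   On a gap (8 c_k, c_{k+1}) only the bumps remain, and the bumps of height at
   least A cover a proportion of it tending to 0 as A grows, because P_p grows
   much faster than p.  If x is any vector, then h must tend to infinity along
   the n such that B^n x is close to 2 e_0, since 2^(h n) x_n stays away from 0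
   while x_n tends to 0.  As c_{k+1} / c_k is unbounded, this set has lower
   density 0, and B is not frequently hypercyclic. *)

Require Import Defs.
From HB Require Import structures.
From mathcomp Require Import all_boot all_order all_algebra.
From mathcomp Require Import all_classical all_reals all_analysis.
From mathcomp Require Import complex.
From mathcomp Require Import zify ring lra.

Set Implicit Arguments.
Unset Strict Implicit.
Unset Printing Implicit Defensive.

Import Order.TTheory GRing.Theory Num.Theory.
Import numFieldNormedType.Exports.

Local Open Scope classical_set_scope.
Local Open Scope ring_scope.

(** * The height function: bumps, ramps and the sparsity of windows *)

Section heights.
Local Open Scope nat_scope.

(** It exceeds [3 * p]: room for the exponent [p + p] of [target_height_le] and for an error
    [2 ^- p]. *)
Definition halfwidth p := 4 * p.+1.
Definition period p := 4 * halfwidth p * 2 ^ p.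
(** Factorials have unbounded successive ratios, and every period divides all large ones. *)
Definition scale k := (k + 8)`!.

(* [m * period p - halfwidth p <= n < m * period p + halfwidth p] for some
   [m >= 1]. *)
Definition window p n :=
  (period p <= n + halfwidth p) &&
  ((n + halfwidth p) %% period p < (halfwidth p).*2).
(** A sawtooth of slope 1, equal to [halfwidth p] at the positive multiples of [period p]. Its
    abrupt drop is harmless: only upward steps can make the weights large. *)
Definition bump p n :=
  if window p n then (n + halfwidth p) %% period p else 0.
Definition ramp k n := if scale k <= n <= 8 * scale k then n - scale k else 0.

(* Index ranges may stop at [n] because the other bumps and ramps vanish at [n]
   (see [window_leq] and [leq_scale]). *)
Definition height n :=
  maxn (\max_(p < n.+1) bump p n) (\max_(k < n.+1) ramp k n).

Lemma halfwidth_le_period p : 4 * halfwidth p <= period p.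
Proof. by rewrite /period leq_pmulr ?expn_gt0. Qed.

Lemma period_gt0 p : 0 < period p.
Proof. by rewrite !muln_gt0 expn_gt0. Qed.

Lemma scaleS k : scale k.+1 = (k + 9) * scale k.
Proof. by rewrite /scale addSn factS -addnS. Qed.

Lemma scale_gt0 k : 0 < scale k.
Proof. exact: fact_gt0. Qed.

Lemma scale_homo k l : k <= l -> scale k <= scale l.
Proof. by move=> kl; rewrite /scale leq_fact // leq_add2r. Qed.

Lemma scale_ltn k l : k < l -> 8 * scale k <= scale l.
Proof.
move=> kl; apply: leq_trans (scale_homo kl).
by rewrite scaleS leq_mul2r; apply/orP; right; lia.
Qed.

Lemma halfwidth_scale k : 2 * halfwidth k <= scale k.
Proof.
rewrite /halfwidth; elim: k => [//|k IHk].
by rewrite scaleS; have := scale_gt0 k; nia.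
Qed.

Lemma scale_inj_interval i k l :
  2 * scale k <= i < 4 * scale k -> 2 * scale l <= i < 4 * scale l -> k = l.
Proof.
move=> ik il; case: (ltngtP k l) => // /scale_ltn; lia.
Qed.

Lemma leq_scale k : k <= scale k.
Proof. have := halfwidth_scale k; rewrite /halfwidth; lia. Qed.

Lemma window_leq p n : window p n -> p <= n.
Proof.
move=> /andP[Pn _]; have := halfwidth_le_period p.
by move: Pn; rewrite /halfwidth; lia.
Qed.

Lemma bump_leq_height p n : bump p n <= height n.
Proof.
rewrite {1}/bump; case: ifP => // pn.
have pn1 : p < n.+1 by exact: window_leq pn.
apply: leq_trans (leq_maxl _ _).
apply: leq_trans (leq_bigmax (Ordinal pn1)).
by rewrite /bump /= pn.
Qed.

Lemma ramp_leq_height k n : ramp k n <= height n.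
Proof.
rewrite {1}/ramp; case: ifP => // kn.
have kn1 : k < n.+1 by have := leq_scale k; lia.
apply: leq_trans (leq_maxr _ _).
apply: leq_trans (leq_bigmax (Ordinal kn1)).
by rewrite /ramp /= kn.
Qed.

(** The bump is 0 where a window starts; at any other point of a window, the preceding integer lies
    in the same window. *)
Lemma bumpS p n : bump p n.+1 <= (bump p n).+1.
Proof.
rewrite /bump /window; have := period_gt0 p.
move: (period p) (halfwidth p) => P L P0.
rewrite addSn modnS; have [_|dP] := boolP (P %| (n + L).+1); first by case: ifP.
case: ifP => // /andP[h1 h2].
have nP : n + L <> P.-1 by move=> h; move: dP; rewrite h prednK // dvdnn.
have -> : P <= n + L.
  move: h1; rewrite leq_eqVlt => /orP[/eqP h|//].
  by move: dP; rewrite -h dvdnn.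
by rewrite /= (ltnW h2).
Qed.

Lemma rampS k n : ramp k n.+1 <= (ramp k n).+1.
Proof. rewrite /ramp; do 2 case: ifP; lia. Qed.

Lemma heightS n : height n.+1 <= (height n).+1.
Proof.
rewrite {1}/height geq_max; apply/andP; split; apply/bigmax_leqP => i _.
- by apply: leq_trans (bumpS _ _) _; rewrite ltnS bump_leq_height.
- by apply: leq_trans (rampS _ _) _; rewrite ltnS ramp_leq_height.
Qed.

Lemma height0 : height 0 = 0.
Proof.
apply/eqP; rewrite -leqn0 geq_max; apply/andP; split; apply/bigmax_leqP => i _.
- rewrite /bump ifF //; apply/negP => /andP[+ _].
  by have := halfwidth_le_period i; rewrite /halfwidth; lia.
- by have := scale_gt0 i; rewrite /ramp; case: ifP; lia.
Qed.

Lemma height_leq n : height n <= n.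
Proof.
elim: n => [|n IHn]; first by rewrite height0.
by apply: leq_trans (heightS n) _.
Qed.

(** For later copies in the same block; [target p] vanishes beyond index [p], hence the bound on the
    remainder. *)
Lemma height_period p s : period p <= s -> s %% period p <= p ->
  halfwidth p <= height s.
Proof.
move=> Ps sp; apply: leq_trans (bump_leq_height p s).
have := halfwidth_le_period p => LP.
have Lp : p < halfwidth p by rewrite /halfwidth; lia.
have E : (s + halfwidth p) %% period p = s %% period p + halfwidth p.
  rewrite -modnDml modn_small //; lia.
rewrite /bump /window E ifT; last by lia.
by lia.
Qed.

Lemma height_scale k l s : k < l -> 2 * scale l <= s + 4 * scale k ->
  s <= 4 * scale l -> halfwidth l <= height s.
Proof.
move=> kl h1 h2; apply: leq_trans (ramp_leq_height l s).
have := scale_ltn kl; have := halfwidth_scale l => h3 h4.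
by rewrite /ramp ifT; lia.
Qed.

Lemma height_scale_interval k s : 2 * scale k <= s < 4 * scale k ->
  halfwidth k <= height s.
Proof.
move=> ks; apply: leq_trans (ramp_leq_height k s).
have := halfwidth_scale k => h3.
by rewrite /ramp ifT; lia.
Qed.

(** Ramps vanish on the gap, and a bump of type [p] stays below [8 * p.+1], twice its halfwidth. *)
Lemma height_gap k q n : 8 * scale k < n < scale k.+1 ->
  8 * q.+1 <= height n -> exists2 p : 'I_n.+1, q < p & window p n.
Proof.
move=> kn hn; have {hn} : 8 * q.+1 <= \max_(p < n.+1) bump p n.
  have r0 : \max_(l < n.+1) ramp l n = 0.
    apply/eqP; rewrite -leqn0; apply/bigmax_leqP => l _.
    rewrite /ramp ifF //; apply/negP => ln.
    by case: (leqP l k) => [/scale_homo|/scale_homo]; lia.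
  by move: hn; rewrite /height r0 maxn0.
have [p ->] : {p : 'I_n.+1 | \max_(p < n.+1) bump p n = bump p n}.
  by apply: bigop.eq_bigmax; rewrite card_ord.
rewrite /bump; case: ifP => [pn h|//]; exists p => //.
by move: pn => /andP[_]; move: h; rewrite /halfwidth; lia.
Qed.

(** Division of [a + L] by [P] injects the window points into a product of sides [(n + L) %/ P] and
    [2 * L], and [2 * L * 2 ^ p] is half a period. Quotient 0 being excluded, the bound also holds
    for small [n]. *)
Lemma card_window p n :
  #|[pred a : 'I_n.+1 | window p a]| * 2 ^ p <= n.
Proof.
set L := halfwidth p; set P := period p.
have LP : 4 * L <= P := halfwidth_le_period p.
have P0 : 0 < P := period_gt0 p.
pose F (a : 'I_n.+1) := ((a + L) %/ P, (a + L) %% P).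
have Fm (a : 'I_n.+1) : window p a ->
    F a \in [seq (i, j) | i <- iota 1 ((n + L) %/ P), j <- iota 0 (2 * L)].
  move=> /andP[aP am]; apply/allpairsP; exists (F a); split => //.
    rewrite mem_iota divn_gt0 // aP /= add1n ltnS leq_div2r // leq_add2r.
    by rewrite -ltnS.
  by rewrite mem_iota add0n mul2n.
have Finj : injective F.
  move=> a b [] h1 h2; apply: val_inj => /=; apply: (@addIn L).
  by rewrite (divn_eq (a + L) P) h1 h2 -divn_eq.
have : #|[pred a : 'I_n.+1 | window p a]| <= (n + L) %/ P * (2 * L).
  rewrite -(size_image F).
  rewrite -(size_iota 1 (_ %/ _)) -(size_iota 0 (2 * L)).
  rewrite -(size_allpairs pair (iota 1 _)).
  apply: uniq_leq_size; first by rewrite map_inj_uniq // enum_uniq.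
  by move=> _ /fintype.imageP[a aw ->]; exact: Fm.
move=> /(leq_mul (leqnn (2 ^ p))); rewrite mulnC => /leq_trans; apply.
have [nL|Ln] := ltnP n L; first by rewrite divn_small; lia.
have := leq_trunc_div (n + L) P; move: ((n + L) %/ P) => D.
rewrite /P /period -/L; lia.
Qed.

End heights.

(** * Criteria for positive upper and lower density *)

Section density.
Context (R : realType).
Implicit Type A : set nat.

Lemma upper_density_gt0 A (c : R) : 0 < c ->
  (forall N, exists2 n, (N <= n)%N & c <= density_ratio R A n) ->
  (0 < upper_density R A)%E.
Proof.
move=> c0 cA; apply: (@lt_le_trans _ _ c%:E); first by rewrite lte_fin.
apply: le_ereal_inf_tmp => _ [V [N _ NV] <-].
have [n Nn cn] := cA N; apply: (@le_trans _ _ (density_ratio R A n)%:E).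
  by rewrite lee_fin.
by apply: ereal_sup_ubound; exists n => //; exact: NV.
Qed.

Lemma lower_density_gt0 A : (0 < lower_density R A)%E ->
  exists2 c : R, 0 < c & \forall n \near \oo, c <= density_ratio R A n.
Proof.
rewrite /lower_density /limn_einf oppe_gt0 => /ereal_inf_lt[_ [V Voo <-] V0].
have [c c0 Vc] : exists2 c : R, 0 < c &
    (ereal_sup [set (\- (EFin \o density_ratio R A))%E x | x in V] <=
     (- c)%:E)%E.
  (* The supremum may be [-oo]; any positive [c] then works. *)
  case: ereal_sup V0 => [r r0||] //; last by exists 1; rewrite // leNye.
  by exists (- r); rewrite ?oppr_gt0 // opprK.
exists c => //; apply: filterS Voo => n Vn.
rewrite -lerN2 -lee_fin; apply: le_trans Vc; apply: ereal_sup_ubound.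
by exists n.
Qed.

End density.

Lemma card_ord_sum m (P : pred nat) :
  #|[pred a : 'I_m | P a]| = (\sum_(a < m) P a)%N.
Proof.
rewrite -sum1_card big_mkcond /=; apply: eq_bigr => a _.
by rewrite unfold_in /=; case: (P a).
Qed.

(** * Sets along which the height tends to infinity *)

Section density_of_heights.
Context (R : realType).
Implicit Type A : set nat.

(** Points before the gap or below [N] are counted trivially; each other one lies in a window of
    type [p > q], and [card_window] bounds these by a geometric series. *)
Lemma card_high A k q N n : n.+1 = scale k.+1 ->
  (forall a, A a -> (N <= a)%N -> (8 * q.+1 <= height a)%N) ->
  #|[pred a : 'I_n.+1 | (a : nat) \in A]|%:R
    <= (8 * scale k).+1%:R + N%:R + n%:R / 2 ^+ q :> R.
Proof.
move=> nk AN.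
have low m M : (\sum_(a < m) (a < M)%N <= M)%N.
  suff -> : (\sum_(a < m) (a < M)%N = minn m M)%N by rewrite geq_minr.
  by elim: m => [|m IHm]; rewrite ?big_ord0 ?big_ord_recr /= ?IHm; lia.
have sub (a : 'I_n.+1) : (((a : nat) \in A) <=
    (a < (8 * scale k).+1 + N) + \sum_(p < n.+1 | q < p) window p a)%N.
  have [|lowa] := ltnP a _; first by case: (_ \in _).
  have [|//] := boolP (_ \in _); rewrite inE => aA.
  have hn : (8 * q.+1 <= height a)%N by apply: AN => //; lia.
  have [|p qp pa] := height_gap (k := k) _ hn.
    by have := ltn_ord a; rewrite -nk; lia.
  have pn : (p < n.+1)%N by have := ltn_ord a; have := ltn_ord p; lia.
  by rewrite add0n (bigD1 (Ordinal pn)) //= pa.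
have geom m : \sum_(p < m | (q < p)%N) n%:R / 2 ^+ p <= n%:R / 2 ^+ q :> R.
  have [mq|qm] := leqP m q.
    rewrite big_pred0; first by rewrite divr_ge0 ?exprn_ge0.
    by move=> p; have := ltn_ord p; lia.
  (* With the last term subtracted, the bound telescopes under induction on [m]. *)
  suff : \sum_(p < m | (q < p)%N) n%:R / 2 ^+ p
      <= n%:R / 2 ^+ q - n%:R / 2 ^+ m.-1 :> R.
    by move=> /le_trans; apply; rewrite gerBl divr_ge0 ?exprn_ge0.
  elim: m qm => // m IHm; rewrite ltnS leq_eqVlt => /predU1P[<-|qm].
    rewrite big_pred0 ?subrr // => p; have := ltn_ord p; lia.
  rewrite big_mkcond big_ord_recr -big_mkcond /= qm.
  apply: le_trans (lerD (IHm qm) (lexx _)) _.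
  have -> : m = m.-1.+1 by rewrite prednK //; lia.
  rewrite /= exprS.
  have : 2 ^+ m.-1 != 0 :> R by rewrite expf_neq0 // pnatr_eq0.
  move: (2 ^+ m.-1) => t t0; rewrite le_eqVlt; apply/orP; left; apply/eqP.
  by field; rewrite t0 expf_neq0 // pnatr_eq0.
apply: (@le_trans _ _ (((8 * scale k).+1 + N)%N%:R +
    \sum_(p < n.+1 | (q < p)%N) #|[pred a : 'I_n.+1 | window p a]|%:R)).
  rewrite -natr_sum -natrD ler_nat (card_ord_sum n.+1 (fun a => a \in A)).
  apply: (@leq_trans (\sum_(a < n.+1) ((a < (8 * scale k).+1 + N) +
    \sum_(p < n.+1 | q < p) window p a)))%N.
    by apply: leq_sum => a _; exact: sub.
  rewrite big_split /=.
  rewrite leq_add ?low // exchange_big leq_sum // => p _.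
  by rewrite card_ord_sum.
rewrite natrD lerD2l.
apply: le_trans (geom n.+1); apply: ler_sum => p _.
rewrite ler_pdivlMr ?exprn_gt0 // -natrX -natrM ler_nat.
exact: card_window.
Qed.

Lemma lower_density_le0 A :
  (forall h, \forall n \near \oo, A n -> (h <= height n)%N) ->
  ~ (0 < lower_density R A)%E.
Proof.
move=> Ah /lower_density_gt0[c c0 [N0 _ N0c]].
have [q qc] : exists q, 2 ^- q < c / 2 :> R.
  exists (Num.bound (c / 2)^-1).
  rewrite invf_plt ?posrE ?exprn_gt0 ?divr_gt0 //.
  exact: upper_nthrootP.
have [N _ AN] := Ah (8 * q.+1)%N.
(* The trivial part of the count will be at most [9 * scale k], while [n] is at least
   [(k + 8) * scale k]; this choice puts it below [c / 2 * n]. *)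
have [k kq kN] : exists2 k, c / 2 * (k + 8)%:R > 9 & (N + N0 < k)%N.
  exists (maxn (N + N0).+1 (Num.bound (18 / c))); last by rewrite leq_maxl.
  have : 18 / c < (Num.bound (18 / c))%:R.
    by apply: archi_boundP; rewrite divr_ge0 // ltW.
  set b := Num.bound _; rewrite ltr_pdivrMr // => hb.
  have : b%:R <= (maxn (N + N0).+1 b + 8)%:R :> R.
    by rewrite ler_nat; lia.
  move: (_ + 8)%:R => m bm; nra.
have [n nk] : exists n, n.+1 = scale k.+1.
  by exists (scale k.+1).-1; rewrite prednK // scale_gt0.
have kn : (k <= n)%N by have := leq_scale k.+1; lia.
have n0 : 0 < n%:R :> R by rewrite ltr0n; lia.
have N0n : (N0 <= n)%N by lia.
have : c <= density_ratio R A n := N0c n N0n.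
rewrite /density_ratio ler_pdivlMr //.
move=> /le_trans/(_ (card_high nk (fun a Aa Na => AN a Na Aa))).
apply/negP; rewrite -ltNge.
have h1 : (8 * scale k).+1%:R + N%:R <= 9 * (scale k)%:R :> R.
  by rewrite -natrD -natrM ler_nat; have := leq_scale k; lia.
have h2 : (k + 8)%:R * (scale k)%:R <= n%:R :> R.
  rewrite -natrM ler_nat -ltnS nk scaleS ltn_mul2r scale_gt0; lia.
have h3 : 0 < (scale k)%:R :> R by rewrite ltr0n scale_gt0.
move: qc n0 kq h1 h2 h3; rewrite -[_ ^- q]/((2 ^+ q)^-1) => qc n0 kq h1 h2 h3.
apply: (le_lt_trans (lerD h1 (lexx _))).
have h4 : n%:R * (2 ^+ q)^-1 < n%:R * (c / 2) by rewrite ltr_pM2l.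
have h5 : c / 2 * ((k + 8)%:R * (scale k)%:R) <= c / 2 * n%:R.
  by rewrite ler_pM2l // divr_gt0.
have h6 : 9 * (scale k)%:R < c / 2 * (k + 8)%:R * (scale k)%:R.
  by rewrite ltr_pM2r.
lra.
Qed.

End density_of_heights.

(** * Archimedean property and separability of the real and complex scalars *)

Section scalars.

Lemma scalar_field_archimedean (R : realType) (K : numFieldType)
    (iota : R -> K) (e : K) : scalar_field iota -> 0 < e ->
  exists k, 2 ^- k < e.
Proof.
have real (r : R) : 0 < r -> exists k, 2 ^- k < r.
  move=> r0; exists (Num.bound r^-1).
  by rewrite invf_plt ?posrE ?exprn_gt0 // upper_nthrootP.
move=> s; case: K iota / s e => [|[a b]]; first exact: real.
rewrite ltcE /= => /andP[/eqP -> a0].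
have [k ka] := real a a0; exists k.
have -> : 2 ^- k = ((2 : R) ^- k)%:C%C by rewrite fmorphV rmorphXn rmorph_nat.
by rewrite ltcR.
Qed.

Lemma scalar_field_expr2 (R : realType) (K : numFieldType) (iota : R -> K) m n :
  scalar_field iota -> iota (2 ^+ m / 2 ^+ n) = 2 ^+ m / 2 ^+ n.
Proof.
move=> s; case: K iota / s => //.
by rewrite rmorphM fmorphV !rmorphXn !rmorph_nat.
Qed.

Lemma scalar_field_separable (R : realType) (K : numFieldType) (iota : R -> K) :
  scalar_field iota ->
  exists d : nat -> K, forall z e, 0 < e -> exists n, `|z - d n| < e.
Proof.
pose q n : R := ratr (odflt 0 (unpickle n)).
have dense_q (x e : R) : 0 < e -> exists n, `|x - q n| < e.
  move=> e0; have [|r] := @rat_in_itvoo _ (x - e) (x + e).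
    by rewrite ltrBlDr -addrA ltrDl addr_gt0.
  rewrite in_itv /= => xr; exists (pickle r).
  by rewrite /q pickleK /= ltr_distlC.
case: K iota /; first by exists q.
exists (fun n =>
  let: (a, b) := odflt (0%N, 0%N) (unpickle n) in (q a +i* q b)%C).
move=> [x y] [e e'] /[!ltcE] /= /andP[/eqP -> e0].
have [a xa] := dense_q x (e / 2) (divr_gt0 e0 (ltr0n _ 2)).
have [b yb] := dense_q y (e / 2) (divr_gt0 e0 (ltr0n _ 2)).
exists (pickle (a, b)); rewrite pickleK /=.
rewrite normc_def ltcE /= eqxx /=.
rewrite -[ltRHS]gtr0_norm // -sqrtr_sqr ltr_sqrt ?exprn_gt0 //.
rewrite -(real_normK (num_real (x - q a))) -(real_normK (num_real (y - q b))).
have := normr_ge0 (x - q a); have := normr_ge0 (y - q b).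
move: xa yb; move: `|_| `|_| => u v; nra.
Qed.

End scalars.

(** * Coordinates and open sets in [c0] *)

Section c0_space.
Variable K : numFieldType.
Implicit Types x y : c0 K.

Lemma null_seq_ltP (u : nat -> K) :
  reflect (forall e, 0 < e -> exists N, forall n, (N <= n)%N -> `|u n| < e)
    (u \in @null_seq K).
Proof.
apply: (iffP (null_seqP u)) => [/cvgr0Pnorm_lt u0 e /u0[N _ uN]|u0].
  by exists N.
by apply/cvgr0Pnorm_lt => e /u0[N uN]; exists N.
Qed.

Lemma c0_coord_le x n : `|x n| <= `|x|.
Proof. exact: c0_norm_ge. Qed.

Lemma c0D x y n : (x + y) n = x n + y n. Proof. by []. Qed.
Lemma c0B x y n : (x - y) n = x n - y n. Proof. by []. Qed.
Lemma c0Z (a : K) x n : (a *: x) n = a * x n. Proof. by []. Qed.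

Lemma c0P x y : x =1 y -> x = y.
Proof. by move=> xy; apply/val_inj/funext. Qed.

Lemma c0_open_ball (U : set (c0 K)) x : open U -> U x ->
  exists2 e : K, 0 < e & forall y, `|y - x| < e -> U y.
Proof.
move=> oU Ux; have /nbhs_ballP[e /= e0 eU] : nbhs x U by exact: open_nbhs_nbhs.
exists e => // y yx; apply: eU.
by rewrite -ball_normE /ball_ /= distrC.
Qed.

End c0_space.

(** * The weighted shift and its failure to be frequently hypercyclic *)

Section weighted_shift.
Variable K : numFieldType.
Implicit Types x : c0 K.

Definition wshift_coord (u : nat -> K) n : K :=
  2 ^+ height n.+1 / 2 ^+ height n * u n.+1.

Lemma expr2_gt0 n : 0 < 2 ^+ n :> K.
Proof. by rewrite exprn_gt0. Qed.

Lemma expr2_neq0 n : 2 ^+ n != 0 :> K.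
Proof. by rewrite gt_eqF ?expr2_gt0. Qed.

Lemma wshift_coord_le u n : `|wshift_coord u n| <= 2 * `|u n.+1|.
Proof.
rewrite /wshift_coord normrM ler_wpM2r // ger0_norm; last first.
  by rewrite divr_ge0 ?exprn_ge0.
rewrite ler_pdivrMr ?expr2_gt0 // -exprS ler_eXn2l ?ltr1n //.
exact: heightS.
Qed.

Lemma wshift_null x : wshift_coord x \in @null_seq K.
Proof.
apply/null_seq_ltP => e e0; have /null_seq_ltP/(_ (e / 2)) := c0_valP x.
rewrite divr_gt0 // => /(_ isT)[N xN]; exists N => n Nn.
apply: le_lt_trans (wshift_coord_le x n) _.
by rewrite mulrC -ltr_pdivlMr // xN // leqW.
Qed.

Definition wshift x : c0 K := C0 (wshift_null x).

Lemma wshiftE x n :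
  wshift x n = 2 ^+ height n.+1 / 2 ^+ height n * x n.+1.
Proof. by []. Qed.

Lemma wshift_linear : linear wshift.
Proof.
move=> a x y; apply: c0P => n.
rewrite c0D c0Z !wshiftE c0D c0Z; ring.
Qed.

HB.instance Definition _ :=
  GRing.isLinear.Build K (c0 K) (c0 K) *:%R wshift wshift_linear.

Lemma wshift_continuous : continuous wshift.
Proof.
apply: bounded_linear_continuous.
exists 2; split; first by rewrite realn.
move=> M M2; have : \forall x \near nbhs (0 : c0 K), ball 0 1 x.
  exact: nbhsx_ballx.
apply: filterS => x; rewrite -ball_normE /ball_ /= sub0r normrN => x1.
apply: c0_norm_le => n; apply: le_trans (wshift_coord_le x n) _.
apply: le_trans (ltW M2); rewrite ler_piMr //.
exact: le_trans (c0_coord_le _ _) (ltW x1).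
Qed.

Lemma iter_wshift n x s :
  iter n wshift x s = 2 ^+ height (n + s) / 2 ^+ height s * x (n + s)%N.
Proof.
elim: n s => [|n IHn] s.
  by rewrite add0n divff ?mul1r ?expr2_neq0.
rewrite iterS wshiftE IHn mulrA addSnnS.
congr (_ * _); move: (expr2_neq0 (height s)) (expr2_neq0 (height s.+1)).
move: (2 ^+ height s) (2 ^+ height s.+1) => a b a0 b0.
by field; rewrite a0 b0.
Qed.

Lemma wshift_unit n : (1 <= n)%N ->
  wshift (c0_unit K n) = (2 ^+ height n / 2 ^+ height n.-1) *: c0_unit K n.-1.
Proof.
case: n => // n _; apply: c0P => m.
rewrite c0Z wshiftE /= eqSS.
by case: eqP => [->|]; rewrite ?mulr0.
Qed.

Lemma wshift_unit0 : wshift (c0_unit K 0) = 0.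
Proof. by apply: c0P => m; rewrite wshiftE /= mulr0. Qed.

Lemma wshift_not_frequently_hypercyclic (R : realType) :
  ~ frequently_hypercyclic R (wshift : {linear c0 K -> c0 K}).
Proof.
(* Within distance 1 of [u], coordinate 0 has modulus above 1, so a visit at time [n] forces
   [2 ^+ height n * x n] to do so. *)
move=> [x xP]; pose u : c0 K := 2 *: c0_unit K 0.
have oU : open (ball u 1) by exact: ball_open.
apply: (@lower_density_le0 R _ _ (xP _ oU _)); last first.
  by exists u; exact: ballxx.
move=> h; have /null_seq_ltP/(_ (2 ^- h)) := c0_valP x.
rewrite invr_gt0 expr2_gt0 => /(_ isT)[N xN]; exists N => // n /= Nn.
rewrite /visits /= -ball_normE /ball_ /= => un.
have := le_lt_trans (c0_coord_le _ 0) un.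
rewrite c0B iter_wshift c0Z /= mulr1 height0 expr0 divr1 addn0 => hn.
rewrite leqNgt; apply/negP => nh.
have : `|2 ^+ height n * x n| < 1.
  rewrite normrM normrX normr_nat.
  apply: le_lt_trans (_ : 2 ^+ h * `|x n| < 1).
    by rewrite ler_wpM2r // ler_eXn2l ?ltr1n // ltnW.
  by rewrite mulrC -ltr_pdivlMr ?expr2_gt0 // div1r xN.
move=> /(ltrD hn)/(le_lt_trans (ler_normD _ _)).
by rewrite subrK normr_nat -[1 + 1]/(2%:R) ltxx.
Qed.

End weighted_shift.

(** * The U-frequently hypercyclic vector *)

Section hypercyclic_vector.
Variables (K : numFieldType) (d : nat -> K).
Hypothesis K_arch : forall e : K, 0 < e -> exists k, 2 ^- k < e.
Hypothesis d_dense : forall z (e : K), 0 < e -> exists n, `|z - d n| < e.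

(* The sequence coded by the 2-adic valuation of [p] reappears for arbitrarily
   large [p], so the truncations in position and in size do no harm. *)
Definition target p t : K :=
  let s := odflt [::] (unpickle (logn 2 p)) in
  let v := if (t < size s)%N then d (nth 0%N s t) else 0 in
  if (t <= p)%N && (`|v| <= 2 ^+ p) then v else 0.

Lemma target_eq0 p t : (p < t)%N -> target p t = 0.
Proof. by move=> pt; rewrite /target leqNgt pt. Qed.

(** Each factor is at most [2 ^+ p]: the first by truncation in size, the second because
    [height t <= t <= p]. *)
Lemma target_height_le p t : `|target p t * 2 ^+ height t| <= 2 ^+ (p + p).
Proof.
have [pt|tp] := ltnP p t; first by rewrite target_eq0 // mul0r normr0 exprn_ge0.
rewrite normrM normrX normr_nat exprD ler_pM ?exprn_ge0 //.
  by rewrite /target; case: ifP => [/andP[]//|_]; rewrite normr0 exprn_ge0.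
by rewrite ler_eXn2l ?ltr1n // (leq_trans (height_leq t)).
Qed.

Lemma expr2_bound (u : nat -> K) N :
  exists m, forall t, (t < N)%N -> `|u t| <= 2 ^+ m.
Proof.
elim: N => [|N [m mP]]; first by exists 0%N.
have [k hk] : exists k, `|u N| <= 2 ^+ k.
  have u1 : 0 < `|u N| + 1 by rewrite ltr_wpDl.
  have [|k] := @K_arch (`|u N| + 1)^-1; first by rewrite invr_gt0.
  rewrite ltf_pV2 ?posrE ?expr2_gt0 // => /ltW h; exists k.
  by apply: le_trans h; rewrite lerDl.
exists (maxn m k) => t; rewrite ltnS leq_eqVlt => /predU1P[->|/mP tm].
  by apply: le_trans hk _; rewrite ler_eXn2l ?ltr1n // leq_maxr.
by apply: le_trans tm _; rewrite ler_eXn2l ?ltr1n // leq_maxl.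
Qed.

Lemma target_dense (x : c0 K) e : 0 < e ->
  exists2 p, 2 ^- p < e & forall t, `|target p t - x t| < e.
Proof.
move=> e0; have /null_seq_ltP/(_ e e0)[N xN] := c0_valP x.
have [F FP] := choice (fun t => d_dense (x t) e0).
have [m mP] := expr2_bound (d \o F) N.
have [k ke] := K_arch e0.
(* The power of 3 enlarges [p] without changing its 2-adic valuation; [k] serves the error [2 ^- p],
   [N] the truncation in position, [m] the one in size. *)
pose s := mkseq F N; pose j := (k + N + m)%N.
pose p := (2 ^ pickle s * 3 ^ j)%N.
have jp : (j <= p)%N.
  apply: leq_trans (ltnW (ltn_expl j (isT : 1 < 3)%N)) _.
  by rewrite leq_pmull // expn_gt0.
have logp : logn 2 p = pickle s.
  by rewrite lognM ?expn_gt0 // !lognX /= muln0 addn0 muln1.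
exists p.
  apply: le_lt_trans ke; rewrite lef_pV2 ?posrE ?expr2_gt0 //.
  by rewrite ler_eXn2l ?ltr1n //; apply: leq_trans jp; rewrite /j; lia.
move=> t; rewrite /target logp pickleK /= size_mkseq.
have [tN|Nt] := ltnP t N; last first.
  by rewrite if_same sub0r normrN xN.
rewrite nth_mkseq // ifT; first by rewrite distrC.
apply/andP; split; first by apply: leq_trans jp; rewrite /j; lia.
apply: le_trans (mP t tN) _; rewrite ler_eXn2l ?ltr1n //.
by apply: leq_trans jp; rewrite /j; lia.
Qed.

Definition in_block i k := (2 * scale k <= i < 4 * scale k)%N.

(* The valuation makes every [p] the type of infinitely many blocks [k]. *)
Definition block_coord k i : K :=
  let p := logn 2 k in let t := (i %% period p)%N in
  target p t * 2 ^+ height t / 2 ^+ height i.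

Definition vec_coord i : K :=
  if [pick k : 'I_i.+1 | in_block i k] is Some k then block_coord k i else 0.

Lemma vec_coord_block i k : in_block i k -> vec_coord i = block_coord k i.
Proof.
move=> ik; rewrite /vec_coord; case: pickP => [l il|/(_ _)].
  by rewrite (scale_inj_interval ik il).
have ki : (k < i.+1)%N by have := leq_scale k; move: ik; rewrite /in_block; lia.
by move=> /(_ (Ordinal ki)) /=; rewrite ik.
Qed.

Lemma vec_coordP i : vec_coord i = 0 \/ exists k, in_block i k.
Proof.
by rewrite /vec_coord; case: pickP => [k ik|]; [right; exists k|left].
Qed.

Lemma ler_expr2_ratio m q h : (m + q <= h)%N -> 2 ^+ m / 2 ^+ h <= 2 ^- q :> K.
Proof.
move=> mqh; rewrite ler_pdivrMr ?expr2_gt0 //.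
by rewrite mulrC ler_pdivlMr ?expr2_gt0 // -exprD ler_eXn2l ?ltr1n.
Qed.

Lemma logn2_leq k : (logn 2 k <= k)%N.
Proof. by case: k => // k; apply/ltnW/ltn_logl. Qed.

(** In block [k] the type is at most [k], so the numerator is at most [2 ^+ (k + k)], while the ramp
    reaches [4 * k.+1]. *)
Lemma vec_null : vec_coord \in @null_seq K.
Proof.
apply/null_seq_ltP => e /K_arch[q qe]; exists (4 * scale q)%N => i qi.
have [->|[k ik]] := vec_coordP i.
  by rewrite normr0; apply: le_lt_trans qe; rewrite invr_ge0 exprn_ge0.
rewrite (vec_coord_block ik) /block_coord normrM normrV ?unitfE ?expr2_neq0 //.
rewrite [X in _ / X]ger0_norm ?exprn_ge0 //.
have qk : (q < k)%N.
  rewrite ltnNge; apply/negP => /scale_homo; move: ik qi.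
  by rewrite /in_block; lia.
apply: le_lt_trans qe; apply: le_trans (ler_wpM2r _ (target_height_le _ _)) _.
  by rewrite invr_ge0 exprn_ge0.
apply: ler_expr2_ratio; have := height_scale_interval ik.
by have := logn2_leq k; rewrite /halfwidth; lia.
Qed.

Definition vec : c0 K := C0 vec_null.

Lemma vecE i : vec i = vec_coord i. Proof. by []. Qed.

Lemma iter_wshift_vec k n s : let p := logn 2 k in
  (period p %| n)%N -> (2 * scale k <= n)%N ->
  (n + period p <= 4 * scale k)%N ->
  `|iter n (@wshift K) vec s - target p s| <= 2 ^- p.
Proof.
move=> p pn kn nk; rewrite iter_wshift vecE.
have nsE : ((n + s) %% period p = s %% period p)%N.
  by rewrite -modnDml (eqP pn) add0n.
(* The division by [2 ^+ height i] in [block_coord] is designed to cancel the weights of the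
   iterated shift. *)
have cancel (a : K) : 2 ^+ height (n + s) / 2 ^+ height s *
    (a / 2 ^+ height (n + s)) = a / 2 ^+ height s.
  move: (expr2_neq0 K (height s)) (expr2_neq0 K (height (n + s))).
  move: (2 ^+ height s) (2 ^+ height (n + s)) => b c b0 c0.
  by field; rewrite b0 c0.
(* The copy at [n] is recovered exactly on one full period; beyond it [target p] vanishes and
   everything is error. *)
have [sP|Ps] := ltnP s (period p).
  rewrite (@vec_coord_block _ k); last by rewrite /in_block; lia.
  rewrite /block_coord -/p nsE modn_small // cancel mulfK ?expr2_neq0 //.
  by rewrite subrr normr0 invr_ge0 exprn_ge0.
have LP := halfwidth_le_period p.
rewrite [target p s]target_eq0 ?subr0; last by rewrite /halfwidth in LP; lia.
have [->|[l il]] := vec_coordP (n + s).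
  by rewrite mulr0 normr0 invr_ge0 exprn_ge0.
rewrite (vec_coord_block il) /block_coord cancel.
set q := logn 2 l; set t := (_ %% _)%N.
have [qt|tq] := ltnP q t.
  by rewrite target_eq0 // !mul0r normr0 invr_ge0 exprn_ge0.
rewrite normrM normrV ?unitfE ?expr2_neq0 //.
rewrite [X in _ / X]ger0_norm ?exprn_ge0 //.
apply: le_trans (ler_wpM2r _ (target_height_le _ _)) _.
  by rewrite invr_ge0 exprn_ge0.
apply: ler_expr2_ratio; move: il; rewrite /in_block => il.
(* An earlier block ends before [n]; a later one is damped by its ramp, the same one by a bump. *)
have [lk|kl|kl] := ltngtP l k.
- by have := scale_ltn lk; lia.
- have : (halfwidth l <= height s)%N.
    by apply: (height_scale kl); lia.
  by have := logn2_leq l; have := logn2_leq k; rewrite /halfwidth -/p -/q; lia.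
- have qp : q = p by rewrite /q kl.
  have : (halfwidth p <= height s)%N.
    by apply: height_period => //; move: tq; rewrite /t -/q qp nsE.
  by rewrite /halfwidth qp; lia.
Qed.

Lemma wshift_U_frequently_hypercyclic (R : realType) :
  U_frequently_hypercyclic R (@wshift K : {linear c0 K -> c0 K}).
Proof.
exists vec => U oU [u Uu]; have [e e0 eU] := c0_open_ball oU Uu.
(* Two errors of [e / 4] per coordinate give norm at most [e / 2], strictly below [e]. *)
have e20 : 0 < e / 2 / 2 by rewrite !divr_gt0.
have [p pe pu] := target_dense u e20.
have visit k n : logn 2 k = p -> (period p %| n)%N -> (2 * scale k <= n)%N ->
    (n + period p <= 4 * scale k)%N -> visits (@wshift K) vec U n.
  move=> kp pn kn nk; apply: eU; apply: (@le_lt_trans _ _ (e / 2)); last first.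
    by rewrite ltr_pdivrMr // ltr_pMr // ltr1n.
  apply: c0_norm_le => s; rewrite [e / 2]splitr c0B.
  rewrite -[_ - _](subrKA (target p s)); apply: le_trans (ler_normD _ _) _.
  apply: lerD; last exact: ltW.
  apply: le_trans (ltW pe).
  by have := @iter_wshift_vec k n s; rewrite kp; apply.
(* Block [k] has [2 * scale k / period p] visits, counted up to [4 * scale k]. *)
apply: (@upper_density_gt0 R _ (2 * (period p)%:R)^-1).
  by rewrite invr_gt0 mulr_gt0 // ltr0n period_gt0.
(* A block of type [p] late enough to lie beyond [N] and for [period p] to divide [scale k]. *)
move=> N; pose k := (2 ^ p * 3 ^ (N + period p))%N.
have kp : logn 2 k = p.
  by rewrite lognM ?expn_gt0 // !lognX /= muln0 addn0 muln1.
have kN : (N + period p <= k)%N.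
  apply: leq_trans (ltnW (ltn_expl _ (isT : 1 < 3)%N)) _.
  by rewrite leq_pmull // expn_gt0.
have P0 := period_gt0 p; have c0 := scale_gt0 k.
exists (4 * scale k)%N; first by have := leq_scale k; lia.
have /dvdnP[r rP] : (period p %| scale k)%N by apply: dvdn_fact; lia.
rewrite /density_ratio ler_pdivlMr; last by rewrite ltr0n; lia.
apply: (@le_trans _ _ (r * 2)%:R); last first.
  rewrite ler_nat.
  pose F (j : 'I_(r * 2)) : 'I_(4 * scale k).+1 :=
    inord (2 * scale k + j * period p).
  have FE (j : 'I_(r * 2)) : F j = (2 * scale k + j * period p)%N :> nat.
    by rewrite inordK //; have := ltn_ord j; nia.
  have Finj : injective F.
    move=> i j /(congr1 val) /=; rewrite !FE => /addnI/eqP.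
    by rewrite eqn_pmul2r // => /eqP/val_inj.
  rewrite -[leqLHS]card_ord -(card_codom Finj); apply: subset_leq_card.
  apply/fintype.subsetP => _ /codomP[j ->]; rewrite unfold_in /= FE inE.
  apply: (visit k) => //.
  - by rewrite rP mulnA -mulnDl dvdn_mull.
  - by rewrite leq_addr.
  - by have := ltn_ord j; nia.
rewrite le_eqVlt; apply/orP; left; apply/eqP.
rewrite rP; move: (period p) P0 => P P0; rewrite !natrM; field.
by rewrite pnatr_eq0 -lt0n.
Qed.

End hypercyclic_vector.

Theorem theorem5 (R : realType) (K : numFieldType) (iota : R -> K)
    (K_scalars : scalar_field iota) :
  exists w : nat -> R,
    (forall n, (1 <= n)%N -> 0 < w n) /\
    (exists M : R, forall n, (1 <= n)%N -> w n <= M) /\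
    exists B : {linear c0 K -> c0 K},
      continuous B /\
      (forall n, (1 <= n)%N ->
         B (c0_unit K n) = iota (w n) *: c0_unit K n.-1) /\
      B (c0_unit K 0%N) = 0 /\
      U_frequently_hypercyclic R B /\
      ~ frequently_hypercyclic R B.
Proof.
exists (fun n => 2 ^+ height n / 2 ^+ height n.-1); split=> [n _|].
  by rewrite divr_gt0 ?expr2_gt0.
split.
  exists 2 => -[//|n _] /=; rewrite ler_pdivrMr ?expr2_gt0 // -exprS.
  by rewrite ler_eXn2l ?ltr1n // heightS.
have arch (e : K) : 0 < e -> exists k, 2 ^- k < e.
  exact: scalar_field_archimedean K_scalars.
have [d d_dense] := scalar_field_separable K_scalars.
exists (@wshift K); split; first exact: wshift_continuous.
split=> [n n1|]; first by rewrite scalar_field_expr2 //; exact: wshift_unit.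
split; first exact: wshift_unit0.
split; last exact: wshift_not_frequently_hypercyclic.
exact: (wshift_U_frequently_hypercyclic arch d_dense).
Qed.
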